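(* Let $n \ge 2$ and consider an instance with key set $\mathcal{K}=\{1,2,\ldots,n\}$ and non-negative weights $w_1,\ldots,w_n$, with total weight $W=\sum_{k=1}^n w_k$. If $\max_{k} w_k \ge \tfrac{3}{7}W$, then there exists an optimal two-way comparison search tree for this instance whose root is an equal-to test. In other words, $\lambda^+ \le \tfrac{3}{7}$.
   Context: A two-way comparison search tree (2WCST) for the key set $\mathcal{K}=\{1,\ldots,n\}$ is a rooted binary tree in which every internal node is either an equal-to test $\langle = k\rangle$ (asking whether the query $q$ equals $k$) or a less-than test $\langle < k\rangle$ (asking whether $q<k$), for some key $k$, each internal node having a ''yes'' child and a ''no'' child, and every leaf is labeled by a key. The search for a query $q\in\mathcal{K}$ starts at the root and follows the branches given by the test outcomes; the tree is required to be correct, i.e. for every $q\in\mathcal{K}$ the search ends at a leaf labeled $q$ (successful-query model). Writing $\mathrm{depth}(k)$ for the depth of the leaf reached by the search for key $k$, the cost of a tree $T$ is $\mathrm{cost}(T)=\sum_{k\in\mathcal{K}} w_k\,\mathrm{depth}(k)$, and a tree is optimal if it has minimum cost among all 2WCSTs for the instance. The threshold $\lambda^+$ is defined as the smallest $\lambda$ such that, for every instance (with $n\ge 2$ keys), if some key has weight at least $\lambda W$ then there is an optimal 2WCST with an equal-to test at the root. *)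

(* Defs.v *)
From mathcomp Require Import all_boot all_order all_algebra.
From mathcomp Require Import all_classical all_reals ereal.

Set Implicit Arguments.
Unset Strict Implicit.
Unset Printing Implicit Defensive.

Import Order.TTheory GRing.Theory Num.Theory.

Local Open Scope classical_set_scope.
Local Open Scope ring_scope.

(* The key set {1, ..., n} is represented by the ordered type 'I_n, the key k
   being the ordinal of value k - 1.  In each test the first subtree is the
   "yes" child and the second one the "no" child. *)
Inductive search_tree (n : nat) : Type :=
| Leaf of 'I_n
| EqTest of 'I_n & search_tree n & search_tree n
| LtTest of 'I_n & search_tree n & search_tree n.

Fixpoint search_leaf n (t : search_tree n) (q : 'I_n) : 'I_n :=
  match t with
  | Leaf k => k
  | EqTest k yes no => if q == k then search_leaf yes q else search_leaf no q
  | LtTest k yes no =>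
      if (q < k)%N then search_leaf yes q else search_leaf no q
  end.

Fixpoint depth n (t : search_tree n) (q : 'I_n) : nat :=
  match t with
  | Leaf _ => 0%N
  | EqTest k yes no => (if q == k then depth yes q else depth no q).+1
  | LtTest k yes no => (if (q < k)%N then depth yes q else depth no q).+1
  end.

(* Leaves that no query reaches are not excluded. *)
Definition is_2WCST n (t : search_tree n) : Prop :=
  forall q : 'I_n, search_leaf t q = q.

Definition has_eq_root n (t : search_tree n) : bool :=
  if t is EqTest _ _ _ then true else false.

Section Cost.
Variables (R : realType) (n : nat) (w : 'I_n -> R).

Definition total_weight : R := \sum_(k < n) w k.

Definition cost (t : search_tree n) : R := \sum_(k < n) w k * (depth t k)%:R.

Definition optimal_2WCST (t : search_tree n) : Prop :=
  is_2WCST t /\ forall t' : search_tree n, is_2WCST t' -> cost t <= cost t'.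

End Cost.

Definition eq_root_threshold (R : realType) (lambda : R) : Prop :=
  forall (n : nat) (w : 'I_n -> R),
    (2 <= n)%N -> (forall k, 0 <= w k) ->
    (exists k, lambda * total_weight w <= w k) ->
    exists t : search_tree n, optimal_2WCST w t /\ has_eq_root t.

(* The set of thresholds is upward closed but not a priori closed, so "the
   smallest threshold" is read as its infimum, which equals the minimum whenever
   the minimum exists; it is taken in \bar R so that no default value occurs. *)
Definition lambda_plus (R : realType) : \bar R :=
  ereal_inf [set lambda%:E | lambda in @eq_root_threshold R].

(* Main.v *)
(* Let m be the heaviest key.  By induction on the set of keys to be found, it
   suffices to treat a tree with a less-than root whose subtree on the side of m
   starts with the test "= m", followed by a tree L, the other side being a
   tree X.  Each competitor has "= m" at the root, which saves one comparison on
   m, and recombines L with the top two to four levels of X.  Since m has at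
   least 3/4 of the weight of all the other keys together, some competitor costs
   no more than the tree as soon as a weighted average of the competitors makes
   every other key at most 3/4 deeper.  In each shape of X such an average
   exists, and often it is exactly 3/4 for every key. *)
Require Import Defs.
From mathcomp Require Import all_classical all_reals ereal.
From mathcomp Require Import all_boot all_order all_algebra.
From mathcomp Require Import zify lra.

Set Implicit Arguments.
Unset Strict Implicit.
Unset Printing Implicit Defensive.

Import Order.TTheory GRing.Theory Num.Theory.

Local Open Scope ring_scope.

(** * Trees and cuts *)

Section Trees.
Variable n : nat.
Implicit Types (o : bool) (a b c k m q x : 'I_n) (S : {set 'I_n}).
Implicit Types (t u X Y U V : search_tree n).

(* [lower true c] is the set of keys that are at least [c]: the flag [o] selects
   one of two mirror-image orientations, so that the heavy key may always be
   assumed to be on the lower side of a cut. *)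
Definition lower o c : {set 'I_n} := [set q : 'I_n | (q < c)%N (+) o].

Definition Cut o c t u := if o then LtTest c u t else LtTest c t u.

Lemma search_leaf_cut o c t u q :
  search_leaf (Cut o c t u) q =
  if q \in lower o c then search_leaf t q else search_leaf u q.
Proof. by rewrite inE; case: o => /=; case: ltnP. Qed.

Lemma depth_cut o c t u q :
  depth (Cut o c t u) q =
  (if q \in lower o c then depth t q else depth u q).+1.
Proof. by rewrite inE; case: o => /=; case: ltnP. Qed.

(** For a fixed orientation the lower sides form a chain under inclusion, so one key in which two of
    them differ tells which is the smaller. *)
Lemma lower_nested o c k x :
  x \in lower o c -> x \notin lower o k -> {subset lower o k <= lower o c}.
Proof. by rewrite !inE => xc xk q; rewrite !inE; case: o xc xk; lia. Qed.

Lemma lower_separates o a b :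
  a != b -> exists c, (a \in lower o c) = (b \notin lower o c).
Proof.
move=> ab; have : (a : nat) != b by [].
by case: (ltnP a b) => ? ?; [exists b | exists a]; rewrite !inE; case: o; lia.
Qed.

(* [t] finds every key of [S], and each of its subtrees is reached by some key
   of [S]. *)
Fixpoint tight S t : bool :=
  match t with
  | Leaf k => S == [set k]
  | EqTest k yes no => [&& k \in S, tight [set k] yes & tight (S :\ k) no]
  | LtTest k yes no =>
      tight (S :&: lower false k) yes && tight (S :\: lower false k) no
  end.

Lemma lowerC o c : lower (~~ o) c = ~: lower o c.
Proof. by apply/setP=> q; rewrite !inE; case: o; case: ltnP. Qed.

Lemma tight_cut o c S t u :
  tight S (Cut o c t u) = tight (S :&: lower o c) t && tight (S :\: lower o c) u.
Proof.
case: o => //=; rewrite andbC; congr (tight _ _ && tight _ _).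
  by rewrite setDE -lowerC.
by rewrite setDE -lowerC.
Qed.

Variant tight_spec o S : search_tree n -> Prop :=
| TightLeaf a of S = [set a] : tight_spec o S (Leaf a)
| TightEq a t X of a \in S & tight (S :\ a) X : tight_spec o S (EqTest a t X)
| TightCut c X Y of tight (S :&: lower o c) X & tight (S :\: lower o c) Y :
    tight_spec o S (Cut o c X Y).

Lemma tightP o S t : tight S t -> tight_spec o S t.
Proof.
case: t => [a /eqP|a y X /and3P[]|c X Y]; [exact: TightLeaf | by move=> *; exact: TightEq |].
have -> : LtTest c X Y = Cut o c (if o then Y else X) (if o then X else Y).
  by case: o.
by rewrite tight_cut => /andP[]; exact: TightCut.
Qed.

Lemma tight_search_leaf S t q : tight S t -> q \in S -> search_leaf t q = q.
Proof.
elim: t S => [a|a y IHy X IHX|c X IHX Y IHY] S /=.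
- by move=> /eqP->; rewrite inE => /eqP.
- move=> /and3P[_ Ty TX] qS; case: eqVneq => [qa|qa].
    by apply: IHy Ty _; rewrite qa inE.
  by apply: IHX TX _; rewrite !inE qa.
- move=> /andP[TX TY] qS; case: ifP => qc.
    by apply: IHX TX _; rewrite !inE qS qc.
  by apply: IHY TY _; rewrite !inE qS qc.
Qed.

Lemma tight_neq0 S t : tight S t -> exists x, x \in S.
Proof.
elim: t S => [a|a y IHy X IHX|c X IHX Y IHY] S /=.
- by move=> /eqP->; exists a; rewrite inE.
- by move=> /and3P[? _ _]; exists a.
- by move=> /andP[/IHX[x]]; rewrite inE => /andP[]; exists x.
Qed.

(** A test that sends all of [S] to one side can be deleted, which makes no key of [S] deeper;
    repeated deletion leaves a tight tree. *)
Lemma tighten S t : S != set0 -> {in S, forall q, search_leaf t q = q} ->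
  exists2 u, tight S u & {in S, forall q, depth u q <= depth t q}%N.
Proof.
elim: t S => [a|a y IHy X IHX|c X IHX Y IHY] S S0 /= St.
- exists (Leaf a) => //=; apply/eqP/setP=> q; rewrite !inE.
  apply/idP/eqP => [/St //|->]; have /set0Pn[x xS] := S0.
  by rewrite (St _ xS).
- case: (boolP (a \in S)) => aS; last first.
    have neqa q : q \in S -> q != a by apply: contraTneq => ->.
    have [|u uT uD] := IHX S S0; first by move=> q qS; rewrite -[RHS]St // (negPf (neqa q qS)).
    by exists u => // q qS; rewrite (negPf (neqa q qS)); apply: leq_trans (uD _ qS) _.
  have [||y' yT yD] := IHy [set a]; first by apply/set0Pn; exists a; rewrite inE.
    by move=> q; rewrite inE => /eqP->; rewrite -[RHS]St // eqxx.
  case: (eqVneq (S :\ a) set0) => Sa.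
    have S1 : S = [set a] by rewrite -(setD1K aS) Sa setU0.
    exists y'; rewrite S1 // => q qa; have := qa; rewrite inE => /eqP->.
    by rewrite eqxx; apply: leq_trans (yD _ _) _ => //; rewrite inE.
  have [|X' XT XD] := IHX _ Sa.
    by move=> q; rewrite !inE => /andP[qa qS]; rewrite -[RHS]St // (negPf qa).
  exists (EqTest a y' X') => [|q qS] /=; first exact/and3P.
  case: eqVneq => [->|qa]; first by rewrite ltnS yD // inE.
  by rewrite ltnS XD // !inE qa.
- have StX : {in S :&: lower false c, forall q, search_leaf X q = q}.
    by move=> q; rewrite !inE addbF => /andP[qS qc]; rewrite -[RHS]St // qc.
  have StY : {in S :\: lower false c, forall q, search_leaf Y q = q}.
    by move=> q; rewrite !inE addbF => /andP[/negPf qc qS]; rewrite -[RHS]St // qc.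
  case: (eqVneq (S :&: lower false c) set0) => [SX|/IHX/(_ StX)[X' XT XD]].
    have neqc q : q \in S -> (q < c)%N = false.
      by move=> qS; move/setP/(_ q): SX; rewrite !inE qS addbF.
    have [||u uT uD] := IHY S => // [q qS|].
      by rewrite StY // !inE qS neqc.
    by exists u => // q qS; rewrite neqc //; apply: leq_trans (uD _ qS) _.
  case: (eqVneq (S :\: lower false c) set0) => [SY|/IHY/(_ StY)[Y' YT YD]].
    have neqc q : q \in S -> (q < c)%N.
      by move=> qS; move/setP/(_ q): SY; rewrite !inE qS addbF andbT => /negbFE.
    have [||u uT uD] := IHX S => // [q qS|].
      by rewrite StX // !inE qS neqc.
    by exists u => // q qS; rewrite neqc //; apply: leq_trans (uD _ qS) _.
  exists (LtTest c X' Y') => [|q qS] /=; first exact/andP.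
  by case: ifP => qc; rewrite ltnS ?XD ?YD // !inE qS qc.
Qed.


(** * Redistributing a tree over the two sides of a cut *)

Lemma tight_cases o S t : tight S t ->
  (exists d X, d \in S /\ {in S, forall q, q != d ->
     search_leaf X q = q /\ (depth X q < depth t q)%N}) \/
  (exists c X Y, [/\ exists2 x, x \in S & x \in lower o c,
     exists2 x, x \in S & x \notin lower o c
   & {in S, forall q, let u := if q \in lower o c then X else Y in
       search_leaf u q = q /\ (depth u q < depth t q)%N}]).
Proof.
case/(tightP o) => [d ->|d y X dS TX|c X Y TX TY].
(* A leaf counts as an equality test on its own key; no other key remains, so the subtree given here
   is only a filler. *)
- by left; exists d, (Leaf d); split=> [|q]; rewrite inE // => /eqP-> /eqP.
- left; exists d, X; split=> // q qS qd /=; rewrite (negPf qd); split=> //.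
  by apply: (tight_search_leaf TX); rewrite !inE qd.
- right; exists c, X, Y.
  have [x /setIP[xS xc]] := tight_neq0 TX.
  have [y /setDP[yS yc]] := tight_neq0 TY.
  split; [by exists x | by exists y | move=> q qS /=; rewrite depth_cut ltnS].
  case: ifPn => qc; split=> //.
    by apply: (tight_search_leaf TX); rewrite in_setI qS.
  by apply: (tight_search_leaf TY); rewrite in_setD qS qc.
Qed.

(** Dropping the root test of [X] gains one level, which pays for a test [= a] on the side of [a]. A
    cut at the root of [X] is reused; an equality test on [d] is replaced by a cut between [a] and
    [d], and the side of [d] keeps the whole of [X]. *)
Lemma redistribute1 o a X S : a \notin S -> tight S X ->
  exists c U V,
   [/\ exists2 x, x \in a |: S & x \in lower o c,
       exists2 x, x \in a |: S & x \notin lower o c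
     & {in a |: S, forall q,
        let t := if q \in lower o c then U else V in
        search_leaf t q = q /\ (depth t q <= if q == a then 1 else depth X q)%N}].
Proof.
move=> aS TX; have neqa q : q \in S -> q != a by apply: contraTneq => ->.
case: (tight_cases o TX) => [[d [Z [dS dZ]]]|[c [Y [Z [[y yS yc] [z zS zc] YZ]]]]].
  have da := neqa _ dS; have [c sep] := lower_separates o da.
  exists c; case: (boolP (a \in lower o c)) sep => ac /= dc.
    exists (EqTest a (Leaf a) Z), X; split.
    - by exists a; rewrite ?setU11.
    - by exists d; rewrite ?dc // setU1r.
    - move=> q /setU1P[->|qS]; first by rewrite ac /= eqxx.
      rewrite (negPf (neqa _ qS)); case: ifPn => qc /=; last first.
        by rewrite (tight_search_leaf TX).
      by rewrite (negPf (neqa _ qS)); apply: dZ => //; apply: contraTneq qc => ->; rewrite dc.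
  exists X, (EqTest a (Leaf a) Z); split.
  - by exists d; rewrite ?dc // setU1r.
  - by exists a; rewrite ?setU11.
  - move=> q /setU1P[->|qS]; first by rewrite (negPf ac) /= eqxx.
    rewrite (negPf (neqa _ qS)); case: ifPn => qc /=.
      by rewrite (tight_search_leaf TX).
    by rewrite (negPf (neqa _ qS)); apply: dZ => //; apply: contraNneq qc => ->; rewrite dc.
exists c, (if a \in lower o c then EqTest a (Leaf a) Y else Y).
exists (if a \in lower o c then Z else EqTest a (Leaf a) Z).
split; [by exists y; rewrite // setU1r | by exists z; rewrite // setU1r |].
move=> q /setU1P[->|qS] /=; first by case: ifP => ac; rewrite ac /= eqxx.
have [] := YZ q qS; have qa := negPf (neqa q qS); rewrite qa.
by case: ifPn => qc; case: ifP => ac /=; rewrite ?qa => *; split=> //; apply: ltnW.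
Qed.

(* The tree that tests [= a], [= b] and continues with [Y] is redistributed over
   the two sides [U] and [V] of a cut.  A key gets deeper or not according to its
   side, because [U] will be used one level below [V]. *)
Definition redistributes2 o a b Y S c U V :=
  let side q := if q \in lower o c then U else V in
  [/\ exists2 x, x \in a |: (b |: S) & x \in lower o c,
      {in a |: (b |: S), forall q, search_leaf (side q) q = q},
      {in S, forall q, depth (side q) q <= depth Y q + (q \notin lower o c)}%N
    & if a \in lower o c then
        [&& b \notin lower o c, depth U a <= 1 & depth V b <= 1]%N
      else (depth V a <= 1)%N && (depth (side b) b <= (b \notin lower o c).+1)%N].

(** Each side starts with the test for its own key, at the price of one level. The upper side may
    grow by that level, so only [U] has to be strictly shallower than [Y]. *)
Lemma redistributes2_apart o a b Y S c U V : a \notin S -> b \notin S ->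
  (a \in lower o c) = (b \notin lower o c) ->
  {in S, forall q, if q \in lower o c
    then search_leaf U q = q /\ (depth U q < depth Y q)%N
    else search_leaf V q = q /\ (depth V q <= depth Y q)%N} ->
  exists U V, redistributes2 o a b Y S c U V.
Proof.
move=> aS bS sep UV.
have neqa q : q \in S -> q != a by apply: contraTneq => ->.
have neqb q : q \in S -> q != b by apply: contraTneq => ->.
case: (boolP (b \in lower o c)) sep => bc ac.
  exists (EqTest b (Leaf b) U), (EqTest a (Leaf a) V); split => /=.
  - by exists b; rewrite // !inE eqxx orbT.
  - move=> q /setU1P[->|/setU1P[->|qS]]; rewrite ?ac ?bc /= ?eqxx //.
    have := UV q qS; case: ifP => _ [uq _] /=; first by rewrite (negPf (neqb q qS)).
    by rewrite (negPf (neqa q qS)).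
  - move=> q qS; have := UV q qS.
    by case: ifP => _ [_ uq] /=; rewrite ?(negPf (neqb q qS)) ?(negPf (neqa q qS)); lia.
  - by rewrite ac bc /= !eqxx.
exists (EqTest a (Leaf a) U), (EqTest b (Leaf b) V); split => /=.
- by exists a; rewrite ?ac // !inE eqxx.
- move=> q /setU1P[->|/setU1P[->|qS]]; rewrite ?ac ?(negPf bc) /= ?eqxx //.
  have := UV q qS; case: ifP => _ [uq _] /=; first by rewrite (negPf (neqa q qS)).
  by rewrite (negPf (neqb q qS)).
- move=> q qS; have := UV q qS.
  by case: ifP => _ [_ uq] /=; rewrite ?(negPf (neqb q qS)) ?(negPf (neqa q qS)); lia.
- by rewrite ac bc /= !eqxx.
Qed.

(** The upper side starts with both tests. They are paid for by the level that [V] gains on [Y] and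
    by the extra level allowed on that side. *)
Lemma redistributes2_above o a b Y S c U V : a \notin S -> b \notin S ->
  a \notin lower o c -> b \notin lower o c ->
  (exists2 x, x \in S & x \in lower o c) ->
  {in S, forall q, if q \in lower o c
    then search_leaf U q = q /\ (depth U q <= depth Y q)%N
    else search_leaf V q = q /\ (depth V q < depth Y q)%N} ->
  exists U V, redistributes2 o a b Y S c U V.
Proof.
move=> aS bS /negPf ac /negPf bc [x xS xc] UV.
have neqa q : q \in S -> q != a by apply: contraTneq => ->.
have neqb q : q \in S -> q != b by apply: contraTneq => ->.
exists U, (EqTest a (Leaf a) (EqTest b (Leaf b) V)); split => /=.
- by exists x; rewrite // !inE xS !orbT.
- move=> q /setU1P[->|/setU1P[->|qS]]; rewrite ?ac ?bc /= ?eqxx //; first by case: eqP.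
  have := UV q qS; case: ifP => _ [uq _] //=.
  by rewrite (negPf (neqa q qS)) (negPf (neqb q qS)).
- move=> q qS; have := UV q qS.
  by case: ifP => _ [_ uq] /=; rewrite ?(negPf (neqb q qS)) ?(negPf (neqa q qS)); lia.
- by rewrite ac bc /= !eqxx; case: eqP.
Qed.

Lemma redistribute2 o a b Y S : a != b -> a \notin S -> b \notin S -> tight S Y ->
  exists c U V, redistributes2 o a b Y S c U V.
Proof.
move=> ab aS bS TY.
have YS q (qS : q \in S) := tight_search_leaf TY qS.
case: (tight_cases o TY) => [[d [Z [dS dZ]]]|[c [Y1 [Y2 [[y yS yc] _ YZ]]]]].
  have [c0 sep0] := lower_separates o ab.
  (* All keys of [S] but [d] gain a level in [Z]; [d] can do without it on the upper side, where [Y]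
     is kept whole. *)
  have apart c : (a \in lower o c) = (b \notin lower o c) -> d \notin lower o c ->
      exists c U V, redistributes2 o a b Y S c U V.
    move=> sep dc; exists c; apply: (redistributes2_apart (U := Z) (V := Y)) => // q qS.
    by case: ifPn => qc; [apply: dZ => //; apply: contraTneq qc => -> | rewrite YS].
  case: (boolP (d \in lower o c0)) => dc0; last exact: apart dc0.
  (* Here [f] is the one of [a], [b] on the same side as [d]. A cut between [d] and [f] leaves [s]
     above it, so either [f] is below and [d], [s] are above, or [d] is below and [f], [s] are
     above. *)
  have [f [s [ff fc0 sc0]]] : exists f s, [/\ (f, s) = (a, b) \/ (f, s) = (b, a),
      f \in lower o c0 & s \notin lower o c0].
    case: (boolP (b \in lower o c0)) sep0 => bc /= ac.
      by exists b, a; split=> //; [right | rewrite ac].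
    by exists a, b; split=> //; left.
  have fS : f \notin S by case: ff => [[-> _]|[-> _]].
  have df : d != f by apply: contraNneq fS => <-.
  have [c1 sep1] := lower_separates o df.
  have sub1 x : x \in lower o c0 -> x \notin lower o c1 -> s \notin lower o c1.
    by move=> xc0 xc1; apply: contra sc0; apply: lower_nested xc0 xc1 s.
  case: (boolP (f \in lower o c1)) sep1 => fc1 /= dc1.
    have sc1 := sub1 d dc0 (negbT dc1).
    by apply: (apart c1) (negbT dc1); case: ff fc1 sc1 => [[-> ->]|[-> ->]] -> // /negPf->.
  have sc1 := sub1 f fc0 fc1.
  exists c1; apply: (redistributes2_above (U := Y) (V := Z)) => //.
  - by case: ff fc1 sc1 => [[-> ->]|[-> ->]].
  - by case: ff fc1 sc1 => [[-> ->]|[-> ->]].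
  - by exists d.
  - move=> q qS; case: ifPn => qc; first by rewrite YS.
    by apply: dZ => //; apply: contraNneq qc => ->; rewrite dc1.
case: (boolP (a \in lower o c == (b \notin lower o c))) => [/eqP sep|].
  exists c; apply: (redistributes2_apart (U := Y1) (V := Y2)) => // q /YZ /=.
  by case: ifP => // _ [? ?]; split=> //; apply: ltnW.
case: (boolP (b \in lower o c)) => bc.
  (* With both keys below the root cut of [Y], the lower side of a cut between them lies inside that
     of [c]. It can therefore use [Y1], a level higher, while the upper side keeps [Y] whole. *)
  rewrite eqbF_neg negbK => ac; have [c0 sep0] := lower_separates o ab.
  exists c0; apply: (redistributes2_apart (U := Y1) (V := Y)) => // q qS.
  case: ifPn => qc; last by rewrite YS.
  suff qc' : q \in lower o c by have := YZ q qS; rewrite /= qc'.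
  case: (boolP (b \in lower o c0)) sep0 => bc0 /= ac0.
    by apply: lower_nested ac (negbT ac0) q qc.
  exact: lower_nested bc bc0 q qc.
rewrite eqb_id => ac.
exists c; apply: (redistributes2_above (U := Y1) (V := Y2)) => //; first by exists y.
by move=> q /YZ /=; case: ifP => // _ [? ?]; split=> //; apply: ltnW.
Qed.

End Trees.

(** * Costs and the averaging argument *)

Section Costs.
Variables (R : realType) (n : nat) (w : 'I_n -> R).
Hypothesis w0 : forall q, 0 <= w q.
Implicit Types (o : bool) (a b c k m q : 'I_n) (S : {set 'I_n}).
Implicit Types (t u X Y L : search_tree n).

Definition cost_on S t : R := \sum_(q in S) w q * (depth t q)%:R.

Lemma ler_cost_on S t u :
  {in S, forall q, depth t q <= depth u q}%N -> cost_on S t <= cost_on S u.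
Proof. by move=> tu; apply: ler_sum => q qS; rewrite ler_wpM2l ?ler_nat ?tu. Qed.

Lemma cost_on_cut o c S t u : cost_on S (Cut o c t u) =
  \sum_(q in S) w q + cost_on (S :&: lower o c) t + cost_on (S :\: lower o c) u.
Proof.
rewrite -addrA [cost_on (S :&: _) _ + _](_ : _ = \sum_(q in S)
    w q * (if q \in lower o c then depth t q else depth u q)%:R); last first.
  rewrite [RHS](big_setID (lower o c)); congr (_ + _); apply: eq_bigr => q.
    by move=> /setIP[_ ->].
  by move=> /setDP[_ /negPf->].
rewrite -big_split; apply: eq_bigr => q _ /=.
by rewrite depth_cut -natr1 mulrDr mulr1 addrC.
Qed.

Lemma cost_on_eq a S t u : a \in S -> cost_on S (EqTest a t u) =
  \sum_(q in S) w q + w a * (depth t a)%:R + cost_on (S :\ a) u.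
Proof.
move=> aS; rewrite -addrA [_ * _ + _](_ : _ = \sum_(q in S)
    w q * (if q == a then depth t q else depth u q)%:R); last first.
  rewrite [RHS](big_setD1 a) //= eqxx; congr (_ + _); apply: eq_bigr => q.
  by rewrite !inE => /andP[/negPf-> _].
rewrite -big_split; apply: eq_bigr => q _ /=.
by rewrite -natr1 mulrDr mulr1 addrC.
Qed.

Definition eq_root_improves S m t :=
  exists2 u, {in S :\ m, forall q, search_leaf u q = q} &
             cost_on S (EqTest m (Leaf m) u) <= cost_on S t.

Lemma improves_trans S m t u :
  cost_on S t <= cost_on S u -> eq_root_improves S m t -> eq_root_improves S m u.
Proof. by move=> tu [v vS vt]; exists v => //; apply: le_trans tu. Qed.

Lemma improves_depth S m t u : {in S :\ m, forall q, search_leaf u q = q} ->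
  {in S, forall q, depth (EqTest m (Leaf m) u) q <= depth t q}%N ->
  eq_root_improves S m t.
Proof. by move=> uS ut; exists u => //; apply: ler_cost_on. Qed.

(** Compared with [u], the tree [t] saves a comparison on [m] and loses at most one on [a], so the
    cost changes by at most [w a - w m]. *)
Lemma exchange_cost S a m t u : a \in S -> m \in S -> w a <= w m ->
  {in S, forall q, depth t q + (q == m) <= depth u q + (q == a)}%N ->
  cost_on S t <= cost_on S u.
Proof.
move=> aS mS wam tu; have wE x : x \in S -> w x = \sum_(q in S) w q * (q == x)%:R.
  move=> xS; rewrite (bigD1 x) //= eqxx mulr1 big1 ?addr0 // => q /andP[_ /negPf->].
  by rewrite mulr0.
suff : cost_on S t + w m <= cost_on S u + w a by lra.
rewrite (wE _ mS) (wE _ aS) -!big_split; apply: ler_sum => q qS /=.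
by rewrite -!mulrDr -!natrD ler_wpM2l ?ler_nat ?tu.
Qed.

Lemma exists_le_average (T : Type) (x0 : T) (f : T -> R) (s : seq T) (x : R) :
  (0 < size s)%N -> \sum_(y <- s) f y <= (size s)%:R * x ->
  exists2 i, (i < size s)%N & f (nth x0 s i) <= x.
Proof.
elim: s => [//|y s IHs] _; rewrite big_cons /= -natr1 mulrDl mul1r => le_x.
case: (leP (f y) x) => fy; first by exists 0%N.
case: s => [|z s] in IHs le_x *; first by move: le_x; rewrite big_nil /=; lra.
have [||i i_s fi] := IHs => //; last by exists i.+1.
lra.
Qed.

(* Since 3/4 is the ratio of 3/7 to 1 - 3/7, the comparison saved on [m] pays for
   an average increase of 3/4 in the depth of all the other keys.  A tree that is
   repeated in [us] gets a larger weight in the average. *)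
Lemma averaging S m t (us : seq (search_tree n)) :
  m \in S -> 3%:R / 7%:R * (\sum_(q in S) w q) <= w m ->
  (1 < depth t m)%N -> (0 < size us)%N ->
  {in S :\ m, forall q, all (fun u => search_leaf u q == q) us &&
     (4 * sumn [seq (depth u q).+1 | u <- us]
        <= size us * (4 * depth t q + 3))%N} ->
  eq_root_improves S m t.
Proof.
move=> mS heavy tm us0 usP.
pose f u := cost_on S (EqTest m (Leaf m) u).
(* The successor counts the new root test [= m], which finds [m] itself at depth one. *)
have fE u : f u = w m + \sum_(q in S :\ m) w q * (depth u q).+1%:R.
  rewrite /f /cost_on (big_setD1 m) //= eqxx mulr1; congr (_ + _).
  by apply: eq_bigr => q; rewrite !inE => /andP[/negPf-> _].
have [||i i_us fi] := @exists_le_average _ t f us (cost_on S t) => //; last first.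
  exists (nth t us i) => // q qS; apply/eqP.
  by have /andP[/all_nthP/(_ i i_us)] := usP q qS.
have -> : \sum_(u <- us) f u = (size us)%:R * w m +
    \sum_(q in S :\ m) w q * (sumn [seq (depth u q).+1 | u <- us])%:R.
  elim: us {us0 usP} => [|u us IHus].
    by rewrite big_nil /= mul0r add0r big1 // => q _; rewrite mulr0.
  rewrite big_cons IHus /= fE -natr1 mulrDl mul1r -!addrA [RHS]addrCA; congr (_ + _).
  rewrite addrCA; congr (_ + _); rewrite -big_split; apply: eq_bigr => q _ /=.
  by rewrite natrD mulrDr.
set s := size us in us0 *.
have s0 : 0 < s%:R :> R by rewrite ltr0n.
have : 4%:R * (\sum_(q in S :\ m) w q * (sumn [seq (depth u q).+1 | u <- us])%:R)
   <= s%:R * (4%:R * cost_on (S :\ m) t + 3%:R * \sum_(q in S :\ m) w q).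
  rewrite !mulr_sumr -big_split !mulr_sumr /=; apply: ler_sum => q qS.
  have /andP[_] := usP q qS; rewrite -(ler_nat R) !natrM natrD natrM => le_q.
  have := ler_wpM2l (w0 q) le_q; lra.
have -> : cost_on S t = w m * (depth t m)%:R + cost_on (S :\ m) t.
  by rewrite /cost_on (big_setD1 m).
move: heavy; rewrite (big_setD1 m) //=.
have : 2%:R * w m <= w m * (depth t m)%:R.
  by rewrite mulrC ler_wpM2l // ler_nat.
set A := \sum_(q in _) _; set B := \sum_(q in _) _; set C := cost_on _ _.
set D := w m * _ => h1 h2 h3.
(* Heaviness gives [3 * A <= 4 * w m], and [m] at depth at least two in [t] gives
   [w m <= D - w m]. *)
have h4 : 3%:R * A <= 4%:R * (D - w m) by lra.
have := ler_wpM2l (ltW s0) h4; lra.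
Qed.

(** * Less-than tests at the root *)

Ltac eval_trees :=
  rewrite /= ?(search_leaf_cut, depth_cut) /= ?(search_leaf_cut, depth_cut) /=.

Section LessThanRoot.
Variables (o : bool) (k : 'I_n) (S : {set 'I_n}) (m : 'I_n) (t L : search_tree n).
Hypothesis mS : m \in S.
Hypothesis heavy : 3%:R / 7%:R * (\sum_(q in S) w q) <= w m.
Hypothesis tm : (1 < depth t m)%N.
Hypothesis tL : {in S :\ m, forall q, q \in lower o k ->
  search_leaf L q = q /\ (depth L q + 2 <= depth t q)%N}.

(** This is the case of a test [= a] at the top of the upper side. Only depth bounds on [t] are
    assumed, so a cut that isolates [a] is covered as well. *)
Lemma improves_upper_eq a X :
  a \in S :\: lower o k -> tight ((S :\: lower o k) :\ a) X ->
  (1 < depth t a)%N ->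
  {in (S :\: lower o k) :\ a, forall q, depth X q + 2 <= depth t q}%N ->
  eq_root_improves S m t.
Proof.
set SX := _ :\ a => /setDP[aS ak] TX ta tX.
have aSX : a \notin SX by rewrite !inE eqxx.
have XS q (qX : q \in SX) := tight_search_leaf TX qX.
have cls q : q \in S :\ m ->
    [\/ [/\ q \in lower o k, q != a, search_leaf L q = q & (depth L q + 2 <= depth t q)%N],
        q = a | [/\ q \notin lower o k, q != a, q \in SX & (depth X q + 2 <= depth t q)%N]].
  move=> qS; case: (boolP (q \in lower o k)) => qk.
    have [Lq dq] := tL qS qk; constructor 1; split=> //.
    by apply: contraTneq qk => ->.
  case: (eqVneq q a) => [->|qa]; [by constructor 2 | constructor 3].
  have qX : q \in SX by move: qS; rewrite !in_setD1 in_setD qa qk /= => /andP[].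
  by split=> //; apply: tX.
have kc c x : x \in a |: SX -> x \in lower o c -> {subset lower o k <= lower o c}.
  move=> xX xc; apply: (lower_nested xc).
  by move: xX => /setU1P[->//|]; rewrite in_setD1 in_setD => /and3P[].
(* Below the root test [= m], [C0] keeps the cut first and [C1] moves [= a] above it. Relative to
   [t], [C0] makes upper keys at most one deeper and lower keys no deeper; [C1] makes [a] no deeper
   and other keys at most one deeper. *)
pose C0 := Cut o k L (EqTest a (Leaf a) X).
pose C1 := EqTest a (Leaf a) (Cut o k L X).
case E: _ / (tightP o TX) => [b SXb|b y Y bX TY|c X1 X2 TX1 TX2]; subst X.
- have ab : a != b by apply: contraNneq aSX => ->; rewrite SXb inE.
  have bk : b \notin lower o k.
    have : b \in SX by rewrite SXb inE.
    by rewrite in_setD1 in_setD => /and3P[].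
  (* Depth increases are at most 0, 1, 1 for lower keys, 1, 0, 1 for [a] and 1, 1, 0 for [b]: on
     average 2/3. *)
  apply: (@averaging _ _ _ [:: C0; C1; EqTest b (Leaf b) (Cut o k L (Leaf a))]) => // q.
  rewrite /C0 /C1 SXb in cls * => /cls[[qk qa Lq dq]|->|[qk qa + dq]].
  + have qb : q != b by apply: contraTneq qk => ->.
    by eval_trees; rewrite qk (negPf qa) (negPf qb) Lq eqxx /=; clear -dq; lia.
  + by eval_trees; rewrite (negPf ak) eqxx (negPf ab) /= eqxx; clear -ta; lia.
  + rewrite in_set1 => /eqP qb; rewrite qb in dq *.
    by eval_trees; rewrite (negPf bk) eqxx (eq_sym b a) (negPf ab) /= eqxx; clear -dq; lia.
- set SY := SX :\ b in TY.
  have ab : a != b by apply: contraNneq aSX => ->.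
  have bS : b \notin SY by rewrite !inE eqxx.
  have aS' : a \notin SY by rewrite in_setD1 (negPf aSX) andbF.
  have SXE : SX = b |: SY by rewrite setD1K.
  have bk : b \notin lower o k by move: bX; rewrite in_setD1 in_setD => /and3P[].
  have [c [U [V [[x xS xc] UV dUV ab_side]]]] := redistribute2 o ab aS' bS TY.
  have {}kc := kc c x; rewrite SXE in kc; have {xS xc}kc := kc xS xc.
  (* [U] sits one level below [V], which matches the asymmetry of [redistributes2]: no key of [SY]
     gets deeper than in [t]. *)
  pose F := Cut o c (Cut o k L U) V.
  pose C2 := EqTest b (Leaf b) (Cut o k L (EqTest a (Leaf a) Y)).
  have UVq q : q \in a |: SX ->
      (if q \in lower o c then search_leaf U q else search_leaf V q) = q.
    by rewrite SXE => /UV /=; case: ifP.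
  have find_F q : q \in S :\ m -> search_leaf F q = q.
    move=> /cls[[qk qa Lq dq]|->|[qk qa qX dq]]; rewrite /F !search_leaf_cut.
    + by rewrite (kc _ qk) qk.
    + by rewrite (negPf ak) UVq // setU11.
    + by rewrite (negPf qk) UVq // setU1r.
  case: ifP ab_side => ac.
    move=> /and3P[bc Ua Vb].
    (* For [C0], [C1], [F] the increases are at most 0, 1, 1 for lower keys, 1, 0, 2 for [a] and 1,
       1, 0 for the rest. Doubling [C1] makes every total 3 out of 4. *)
    apply: (@averaging _ _ _ [:: C0; C1; C1; F]) => // q qS.
    rewrite /= find_F // eqxx /C0 /C1 /F.
    case/cls: qS => [[qk qa Lq dq]|->|[qk qa qX dq]].
    + by eval_trees; rewrite qk (kc _ qk) (negPf qa) Lq eqxx /=; clear -dq; lia.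
    + by eval_trees; rewrite (negPf ak) ac eqxx /= eqxx; clear -ta Ua; lia.
    + have Xq := XS _ qX; move: Xq dq; eval_trees; rewrite (negPf qk) (negPf qa).
      case: (eqVneq q b) => [->|qb] Xq dq.
        by rewrite Xq eqxx (negPf bc) /=; clear -dq Vb; lia.
      rewrite Xq eqxx /=.
      have := dUV q; rewrite in_setD1 qb qX => /(_ isT).
      by clear -dq; case: ifP => /=; lia.
  move=> /andP[Va sb].
  (* For [C0], [C1], [C2], [F] the increases are at most 0, 1, 1, 1 for lower keys, 1, 0, 2, 1 for
     [a], 1, 1, -1, 1 for [b] and 1, 1, 1, 0 for the rest. The multiplicities 2, 3, 1, 2 solve for a
     total of 6 out of 8 in each row. *)
  apply: (@averaging _ _ _ [:: C0; C0; C1; C1; C1; C2; F; F]) => // q qS.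
  rewrite /= find_F // eqxx /C0 /C1 /C2 /F.
  case/cls: qS => [[qk qa Lq dq]|->|[qk qa qX dq]].
  + have qb : q != b by apply: contraTneq qk => ->.
    by eval_trees; rewrite qk (kc _ qk) (negPf qa) (negPf qb) Lq eqxx /=; clear -dq; lia.
  + by eval_trees; rewrite (negPf ak) ac eqxx (negPf ab) /= ?eqxx; clear -ta Va; lia.
  + have Xq := XS _ qX; move: Xq dq; eval_trees; rewrite (negPf qk) (negPf qa).
    case: (eqVneq q b) => [->|qb] Xq dq.
      by rewrite Xq eqxx /=; move: sb; clear -dq; case: ifP => _ /=; lia.
    rewrite Xq eqxx /=.
    have := dUV q; rewrite in_setD1 qb qX => /(_ isT).
    by clear -dq; case: ifP => /=; lia.
- have [x xX] := tight_neq0 TX1; have /setIP[xX' xc] := xX.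
  have X1q q : q \in SX -> q \in lower o c -> search_leaf X1 q = q.
    by move=> qX qc; apply: (tight_search_leaf TX1); rewrite in_setI qX.
  have X2q q : q \in SX -> q \notin lower o c -> search_leaf X2 q = q.
    by move=> qX qc; apply: (tight_search_leaf TX2); rewrite in_setD qX qc.
  case: (boolP (a \in lower o c)) => ac; last first.
    have kc' := kc c x (setU1r _ xX') xc.
    (* The third tree raises the cut [c] above [k]: it adds at most one level for lower keys and
       [a], and none for the rest, so the average is 2/3. *)
    apply: (@averaging _ _ _ [:: C0; C1;
      Cut o c (Cut o k L X1) (EqTest a (Leaf a) X2)]) => // q qS.
    rewrite /C0 /C1.
    case/cls: qS => [[qk qa Lq dq]|->|[qk qa qX dq]].
    + by eval_trees; rewrite qk (kc' _ qk) (negPf qa) Lq eqxx /=; clear -dq; lia.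
    + by eval_trees; rewrite (negPf ak) (negPf ac) eqxx /= eqxx; clear -ta; lia.
    + move: dq (X1q _ qX) (X2q _ qX); eval_trees; rewrite (negPf qk) (negPf qa).
      case: (boolP (q \in lower o c)) => qc dq.
        by move=> -> // _; rewrite eqxx /=; clear -dq; lia.
      by move=> _ -> //; rewrite eqxx /=; clear -dq; lia.
  have aS1 : a \notin SX :&: lower o c by rewrite in_setI (negPf aSX).
  have [d [U [V [[y yS yd] [z zS zd] UV]]]] := redistribute1 o aS1 TX1.
  have kd : {subset lower o k <= lower o d}.
    apply: kc yd; move: yS; rewrite !in_setU1 in_setI.
    by case: eqP => //= _ /andP[].
  have dc : {subset lower o d <= lower o c}.
    apply: lower_nested zd; move: zS; rewrite !in_setU1 in_setI.
    by case: eqP => [->//|/= _ /andP[]].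
  (* The last tree adds at most 1 for lower keys, 2 for [a] and 0 for the rest; with [C1] doubled
     every total is 3 out of 4. *)
  apply: (@averaging _ _ _ [:: C0; C1; C1;
    Cut o d (Cut o k L U) (Cut o c V X2)]) => // q qS.
  rewrite /C0 /C1.
  case/cls: qS => [[qk qa Lq dq]|->|[qk qa qX dq]].
  + by eval_trees; rewrite qk (kd _ qk) (negPf qa) Lq eqxx /=; clear -dq; lia.
  + have := UV a (setU11 _ _); eval_trees; rewrite (negPf ak) eqxx ac /= eqxx.
    by case: ifP => _ [-> da]; rewrite eqxx; clear -ta da; lia.
  + case: (boolP (q \in lower o c)) => qc; last first.
      have qd : q \notin lower o d by apply: contra qc; apply: dc.
      move: dq; eval_trees.
      by rewrite (negPf qk) (negPf qa) (negPf qc) (negPf qd) X2q // eqxx /= => dq; clear -dq; lia.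
    have qS1 : q \in SX :&: lower o c by rewrite in_setI qX.
    have := UV q (setU1r _ qS1); move: dq; eval_trees.
    rewrite (negPf qk) (negPf qa) qc X1q // eqxx /= => dq.
    by case: ifP => _ [-> da]; rewrite eqxx /=; clear -dq da; lia.
Qed.
Lemma improves_upper X :
  {in S, forall q, w q <= w m} -> tight (S :\: lower o k) X ->
  {in S :\: lower o k, forall q, depth X q + 1 <= depth t q}%N ->
  eq_root_improves S m t.
Proof.
set SX := S :\: lower o k => wmax TX tX.
have cls q : q \in S :\ m ->
    [\/ [/\ q \in lower o k, search_leaf L q = q & (depth L q + 2 <= depth t q)%N]
      | [/\ q \notin lower o k, q \in SX, search_leaf X q = q & (depth X q + 1 <= depth t q)%N]].
  move=> qS; case: (boolP (q \in lower o k)) => qk.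
    by have [Lq dq] := tL qS qk; constructor 1.
  have qX : q \in SX by move: qS; rewrite in_setD1 in_setD qk => /andP[].
  by constructor 2; split=> //; [apply: tight_search_leaf qX | apply: tX].
have kc c x : x \in SX -> x \in lower o c -> {subset lower o k <= lower o c}.
  by move=> xX xc; apply: (lower_nested xc); move: xX => /setDP[].
pose C0 := Cut o k L X.
case E: _ / (tightP o TX) => [a SXa|a y Y aX TY|j X1 X2 TX1 TX2]; subst X.
- have : a \in SX by rewrite SXa set11.
  move=> /setDP[aS ak]; exists C0 => [q|].
    rewrite search_leaf_cut => /cls[[qk Lq _]|[qk _ Rq _]]; first by rewrite qk.
    by rewrite (negPf qk).
  (* Only [a] gets deeper, by one level, while [m] rises by at least one; the maximality of [w m]
     suffices without averaging. *)
  apply: (exchange_cost aS mS); first exact: wmax.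
  move=> q qS; case: (eqVneq q m) => [->|qm] /=.
    by rewrite eqxx; clear -tm; lia.
  have qSm : q \in S :\ m by rewrite in_setD1 qm.
  rewrite (negPf qm) depth_cut; have [[qk _ dq]|[qk + _ dq]] := cls _ qSm.
    by rewrite qk; clear -dq; lia.
  by rewrite SXa => /set1P qa; rewrite (negPf qk) -qa eqxx; move: dq => /=; clear; lia.
- apply: (improves_upper_eq aX TY).
    by have := tX a aX; rewrite /= eqxx; clear; lia.
  move=> q; rewrite in_setD1 => /andP[qa qX].
  by have := tX q qX; rewrite /= (negPf qa); clear; lia.
have [x /setIP[xX xj]] := tight_neq0 TX1.
have kj := kc _ _ xX xj.
case E: _ / (tightP o TX1) => [a Xa|a y Y aX TY|i Y Z TY TZ]; subst X1.
- have : a \in SX :&: lower o j by rewrite Xa set11.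
  move=> /setIP[aX aj].
  (* The cut [j] isolates [a] among the upper keys, so it acts as [= a] followed by [X2]. *)
  have XE : SX :\ a = SX :\: lower o j.
    apply/setP=> q; rewrite in_setD1 in_setD; case: (boolP (q \in SX)) => qX.
      by rewrite -in_set1 -Xa in_setI qX.
    by rewrite !andbF.
  apply: (improves_upper_eq aX (X := X2)); rewrite ?XE //.
    by have := tX a aX; rewrite depth_cut aj; clear; lia.
  move=> q /setDP[qX qj]; have := tX q qX; rewrite depth_cut (negPf qj); clear; lia.
- move: aX => /setIP[aX aj].
  have aY : a \notin (SX :&: lower o j) :\ a by rewrite !inE eqxx.
  have [c [U [V [[u uX uc] [v vX vc] UV]]]] := redistribute1 o aY TY.
  have XE : a |: (SX :&: lower o j) :\ a = SX :&: lower o j.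
    by rewrite setD1K // in_setI aX.
  rewrite XE in uX vX UV.
  have kc' : {subset lower o k <= lower o c}.
    by apply: (kc c u) uc; move: uX => /setIP[].
  have cj : {subset lower o c <= lower o j}.
    by apply: lower_nested vc; move: vX => /setIP[].
  (* For the three distinct trees the increases are at most 0, 2, 1 for lower keys, 1, 0, 1 for [a],
     1, 1, 0 in [Y] and 1, 0, 1 in [X2]; doubling [C0] makes every total 3 out of 4. *)
  apply: (@averaging _ _ _ [:: C0; C0;
    Cut o j (EqTest a (Leaf a) (Cut o k L Y)) X2;
    Cut o c (Cut o k L U) (Cut o j V X2)]) => // q qS.
  rewrite /C0; case/cls: qS => [[qk Lq dq]|[qk qX Xq dq]].
    have qa : q != a by apply: contraTneq qk => ->; case/setDP: aX.
    by eval_trees; rewrite qk (kj _ qk) (kc' _ qk) (negPf qa) Lq eqxx /=; clear -dq; lia.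
  move: Xq dq; eval_trees; rewrite (negPf qk).
  case: (boolP (q \in lower o j)) => qj; last first.
    have qc : q \notin lower o c by apply: contra qj; apply: cj.
    by rewrite (negPf qc) => -> dq; rewrite eqxx /=; clear -dq; lia.
  have := UV q; rewrite in_setI qX qj => /(_ isT) /=.
  case: (eqVneq q a) => [->|qa].
    by case: ifP => _ [-> dq'] -> dq; rewrite !eqxx /=; clear -dq dq'; lia.
  by case: ifP => _ [-> dq'] -> dq; rewrite !eqxx /=; clear -dq dq'; lia.
- have [u /setIP[/setIP[uX uj] ui]] := tight_neq0 TY.
  have [v /setDP[/setIP[vX vj] vi]] := tight_neq0 TZ.
  have ki := kc _ _ uX ui; have ij := lower_nested vj vi.
  (* The increases are at most 0, 1, 1 for lower keys, 1, 1, 0 in [Y] and [Z], and 1, 0, 1 in [X2]: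
     on average 2/3. *)
  apply: (@averaging _ _ _ [:: C0; Cut o j (Cut o k L (Cut o i Y Z)) X2;
    Cut o i (Cut o k L Y) (Cut o j Z X2)]) => // q qS.
  rewrite /C0; case/cls: qS => [[qk Lq dq]|[qk qX Xq dq]].
    by eval_trees; rewrite qk (kj _ qk) (ki _ qk) Lq eqxx /=; clear -dq; lia.
  move: Xq dq; eval_trees; rewrite (negPf qk).
  case: (boolP (q \in lower o j)) => qj; last first.
    have qi : q \notin lower o i by apply: contra qj; apply: ij.
    by rewrite (negPf qi) => -> dq; rewrite eqxx /=; clear -dq; lia.
  by case: ifP => _ -> dq; rewrite eqxx /=; clear -dq; lia.
Qed.
End LessThanRoot.

(** Induction on the size of [S]: [m] stays heavy in any subset containing it, so [= m] can be moved
    to the top of the subtree that holds [m]. Below an equality test on [a] the two tests are then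
    swapped, as [w a <= w m]; below a cut, [improves_upper] applies. *)
Lemma heavy_eq_root S m t :
  m \in S -> {in S, forall q, w q <= w m} ->
  3%:R / 7%:R * (\sum_(q in S) w q) <= w m -> S :\ m != set0 ->
  {in S, forall q, search_leaf t q = q} -> eq_root_improves S m t.
Proof.
have [N] := ubnP #|S|; elim: N S t => // N IHN S t0 ltSN mS wmax heavy Sm t0S.
have heavy_sub S' : S' \subset S -> 3%:R / 7%:R * (\sum_(q in S') w q) <= w m.
  move=> S'S; apply: le_trans heavy; rewrite ler_wpM2l ?divr_ge0 //.
  by rewrite [leRHS](big_setID S') (setIidPr S'S) lerDl sumr_ge0.
have S0 : S != set0 by apply/set0Pn; exists m.
have [t TS le_t] := tighten S0 t0S.
apply: (improves_trans (ler_cost_on le_t)) => {t0 t0S le_t}.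
case: t TS => [a /eqP Sa|a y X|c X Y].
- by move: mS Sm; rewrite Sa => /set1P->; rewrite setDv eqxx.
- case/and3P=> aS Ty TX; have Xq q : q \in S :\ a -> search_leaf X q = q.
    exact: tight_search_leaf TX.
  case: (eqVneq a m) => [am|am].
    apply: (improves_depth (u := X)) => [q|q qS /=]; first by rewrite -am; apply: Xq.
    by rewrite am; case: eqP.
  have mSa : m \in S :\ a by rewrite in_setD1 eq_sym am.
  have [Sam|Sam] := eqVneq ((S :\ a) :\ m) set0.
    have aS' q : q \in S :\ m -> q = a.
      move=> qS; apply/eqP/negbNE/negP => qa.
      by have := in_set0 q; rewrite -Sam !in_setD1 qa -in_setD1 qS.
    apply: (improves_depth (u := Leaf a)) => [q /aS' //|q qS /=].
    by case: eqP.
  have [||||||u uS le_u] := IHN (S :\ a) X => //.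
  + by move: ltSN; rewrite (cardsD1 a S) aS.
  + by move=> q /setD1P[_ /wmax].
  + by apply: heavy_sub; apply: subD1set.
  pose t1 := EqTest a (Leaf a) (EqTest m (Leaf m) u).
  have le_t1 : cost_on S t1 <= cost_on S (EqTest a y X).
    rewrite [cost_on S t1]cost_on_eq // [leRHS]cost_on_eq // lerD // lerD2l /= ler_wpM2l // ler_nat; lia.
  apply: improves_trans le_t1 _.
  exists (EqTest a (Leaf a) u) => [q /setD1P[qm qS] /=|].
    by case: eqP => [->|/eqP qa] //; apply: uS; rewrite !in_setD1 qm qa.
  apply: (exchange_cost aS mS (wmax a aS)) => q qS /=.
  case: (eqVneq q m) => [->|qm]; first by rewrite eq_sym (negPf am).
  by case: (eqVneq q a).
(* The orientation is chosen to put [m] on the lower side. *)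
- pose o := m \notin lower false c; have mc : m \in lower o c.
    by rewrite /o; case: (boolP (m \in lower false c)) => //=; rewrite !inE addbF addbT.
  have -> : LtTest c X Y = Cut o c (if o then Y else X) (if o then X else Y).
    by case: o mc.
  move: (if o then Y else X) (if o then X else Y) => {}X {}Y.
  rewrite tight_cut => /andP[TX TY].
  have mS1 : m \in S :&: lower o c by rewrite in_setI mS.
  have [S1m|S1m] := eqVneq ((S :&: lower o c) :\ m) set0.
    have notlow q : q \in S -> q != m -> q \notin lower o c.
      move=> qS qm; apply/negP => qc.
      by have := in_set0 q; rewrite -S1m in_setD1 in_setI qm qS qc.
    apply: (improves_depth (u := Y)) => [q /setD1P[qm qS]|q qS /=].
      by apply: (tight_search_leaf TY); rewrite in_setD qS notlow.
    by rewrite depth_cut; case: eqVneq => // qm; rewrite (negPf (notlow _ qS qm)).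
  have [||||u uS le_u] := IHN (S :&: lower o c) X _ mS1 _ _ S1m => //.
  + have [y /setDP[yS yc]] := tight_neq0 TY.
    rewrite -ltnS (leq_trans _ ltSN) // ltnS; apply: proper_card.
    by rewrite properE subsetIl; apply/subsetPn; exists y; rewrite // in_setI (negPf yc) andbF.
  + by move=> q /setIP[/wmax].
  + exact/heavy_sub/subsetIl.
  + by move=> q; apply: tight_search_leaf TX.
  have le_t1 : cost_on S (Cut o c (EqTest m (Leaf m) u) Y) <= cost_on S (Cut o c X Y).
    by rewrite !cost_on_cut lerD2r lerD2l.
  apply: improves_trans le_t1 _; apply: (improves_upper mS heavy (L := u) _ _ wmax TY).
  + by rewrite depth_cut mc /= eqxx.
  + move=> q /setD1P[qm qS] qc; rewrite depth_cut qc /= (negPf qm) addn2; split=> //.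
    by apply: uS; rewrite in_setD1 in_setI qm qS.
  + by move=> q /setDP[_ qc]; rewrite depth_cut (negPf qc) addn1.
Qed.

(** * Existence of optimal trees *)

(** There are infinitely many trees but finitely many root tests. For each test that splits [S]
    properly, optimal trees on smaller key sets give a best tree, and the cheapest of these is
    optimal. *)
Lemma optimal_on_exists S : S != set0 -> exists2 t : search_tree n,
  {in S, forall q, search_leaf t q = q} &
  forall u, {in S, forall q, search_leaf u q = q} -> cost_on S t <= cost_on S u.
Proof.
suff H : S != set0 -> exists2 t : search_tree n,
  {in S, forall q, search_leaf t q = q} &
  forall u, tight S u -> cost_on S t <= cost_on S u.
  move=> S0; have [t tS tmin] := H S0; exists t => // u uS.
  have [v vT vu] := tighten S0 uS.
  by apply: le_trans (tmin _ vT) _; apply: ler_cost_on.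
have [N] := ubnP #|S|; elim: N S => // N IHN S ltSN S0.
have IH S' x : S' \subset S -> x \in S -> x \notin S' -> S' != set0 ->
    exists2 t : search_tree n, {in S', forall q, search_leaf t q = q} &
      forall u, tight S' u -> cost_on S' t <= cost_on S' u.
  move=> S'S xS xS' S'0; apply: IHN S'0.
  rewrite -ltnS (leq_trans _ ltSN) // ltnS; apply: proper_card.
  by rewrite properE S'S; apply/subsetPn; exists x.
have [a aS] := set0Pn _ S0.
have [Sa|Sa] := eqVneq (S :\ a) set0.
  have SE : S = [set a] by rewrite -(setD1K aS) Sa setU0.
  exists (Leaf a) => [q|u _]; first by rewrite SE => /set1P->.
  rewrite [cost_on S (Leaf a)]big1 => [|q _]; last by rewrite mulr0.
  by apply: sumr_ge0 => q _; rewrite mulr_ge0.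
pose proper_test (i : bool * 'I_n) := if i.1 then i.2 \in S else
  (S :&: lower false i.2 != set0) && (S :\: lower false i.2 != set0).
have root i : exists t : search_tree n, proper_test i ->
    {in S, forall q, search_leaf t q = q} /\
    forall u, tight S u ->
      match u with Leaf _ => False | EqTest k _ _ => i = (true, k)
                 | LtTest k _ _ => i = (false, k) end ->
      (* An improper test receives the arbitrary tree [Leaf a], so that one function [F] can be
         chosen on all tests. *)
      cost_on S t <= cost_on S u.
  case: i => [[] k]; rewrite /proper_test /=; last first.
    case: (boolP (_ && _)) => [/andP[S1 S2]|_]; last by exists (Leaf a).
    have [x /setIP[xS xk]] := set0Pn _ S1.
    have [y /setDP[yS yk]] := set0Pn _ S2.
    have [|t tS tmin] := IH _ y (subsetIl S (lower false k)) yS _ S1.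
      by rewrite in_setI (negPf yk) andbF.
    have [|u uS umin] := IH _ x (subsetDl S (lower false k)) xS _ S2.
      by rewrite in_setD xk.
    exists (Cut false k t u) => _; split=> [q qS|[//|//|k' X Y] TXY [kk']].
      rewrite search_leaf_cut; case: ifPn => qk; first by rewrite tS // in_setI qS.
      by rewrite uS // in_setD qS qk.
    move: TXY; rewrite -kk' -[LtTest k X Y]/(Cut false k X Y) tight_cut => /andP[TX TY].
    by rewrite !cost_on_cut lerD ?lerD2l ?tmin ?umin.
  case: (boolP (k \in S)) => kS; last by exists (Leaf a).
  have [Sk|Sk] := eqVneq (S :\ k) set0.
    have SE : S = [set k] by rewrite -(setD1K kS) Sk setU0.
    exists (Leaf k) => _; split=> [q|u _ _]; first by rewrite SE => /set1P->.
    by apply: ler_cost_on.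
  have [|t tS tmin] := IH _ k (subD1set S k) kS _ Sk; first by rewrite !inE eqxx.
  exists (EqTest k (Leaf k) t) => _; split=> [q qS|[//|k' Y X|//] TXY [kk']] /=.
    by case: eqP => [->//|/eqP qk]; rewrite tS // in_setD1 qk.
  move: TXY; rewrite -kk' /= => /and3P[_ _ TX].
  by rewrite !cost_on_eq // lerD ?tmin // lerD2l ler_wpM2l // ler_nat.
have {root}[F FP] := fin_all_exists root.
have [i Pi imin] := @arg_minP _ _ _ (true, a) proper_test (fun i => cost_on S (F i)) aS.
have [FS _] := FP i Pi; exists (F i) => // u Tu.
suff [j [Pj ju]] : exists j, proper_test j /\ match u with Leaf _ => False
    | EqTest k _ _ => j = (true, k) | LtTest k _ _ => j = (false, k) end.
  by apply: le_trans (imin j Pj) _; apply: (FP j Pj).2 ju.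
case: u Tu => [k /eqP SE|k y X /and3P[kS _ _]|k X Y].
- by move: aS Sa; rewrite SE => /set1P->; rewrite setDv eqxx.
- by exists (true, k).
- move=> /andP[TX TY]; exists (false, k); split=> //.
  by apply/andP; split; apply/set0Pn; apply: tight_neq0; eassumption.
Qed.

(** * Passage to the full key set and to the threshold *)

Lemma eq_root_optimal m : (1 < n)%N -> (forall q, w q <= w m) ->
  3%:R / 7%:R * total_weight w <= w m ->
  exists t, optimal_2WCST w t /\ has_eq_root t.
Proof.
move=> n1 wmax heavy.
have costE t : cost_on setT t = cost w t.
  by apply: eq_bigl => q; rewrite in_setT.
have sumE : \sum_(q in [set: 'I_n]) w q = total_weight w.
  by apply: eq_bigl => q; rewrite in_setT.
have [|t tS tmin] := @optimal_on_exists setT; first by apply/set0Pn; exists m.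
have Tm : [set: 'I_n] :\ m != set0.
  by rewrite -card_gt0 cardsDS ?subsetT // cardsT card_ord cards1 subn_gt0.
have [|||||u uS le_u] := @heavy_eq_root setT m t => //.
- by rewrite in_setT.
- by rewrite sumE.
exists (EqTest m (Leaf m) u); split=> //; split=> [q|t' t'S] /=.
  by case: eqP => [->//|/eqP qm]; apply: uS; rewrite !inE qm.
by rewrite -!costE; apply: le_trans le_u _; apply: tmin => q _; apply: t'S.
Qed.
End Costs.

Theorem theorem1 (R : realType) :
  (forall (n : nat) (w : 'I_n -> R),
     (2 <= n)%N ->
     (forall k : 'I_n, 0 <= w k) ->
     3%:R / 7%:R * total_weight w <= \big[Num.max/0]_(k < n) w k ->
     exists t : search_tree n, optimal_2WCST w t /\ has_eq_root t)
  /\ (lambda_plus R <= (3%:R / 7%:R)%:E)%E.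
Proof.
have main n (w : 'I_n -> R) : (2 <= n)%N -> (forall k : 'I_n, 0 <= w k) ->
     3%:R / 7%:R * total_weight w <= \big[Num.max/0]_(k < n) w k ->
     exists t : search_tree n, optimal_2WCST w t /\ has_eq_root t.
  case: n w => // n w n1 w0 heavy.
  have [m _ wmax] := @arg_maxP _ _ _ ord0 xpredT w isT.
  have le_wm k : w k <= w m by apply: wmax.
  apply: (eq_root_optimal w0 n1 le_wm); apply: le_trans heavy _.
  (* The default value 0 of the maximum is at most [w m] because weights are non-negative. *)
  by apply/bigmax_leP; split.
split=> //; apply: ereal_inf_lbound; exists (3%:R / 7%:R) => //.
move=> n w n1 w0 [k wk]; apply: main => //.
by apply: le_trans wk _; apply: le_bigmax.
Qed.
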